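(* The bigraded Betti numbers of a $\mathbb Z^2$-module do not determine its GRI over zigzag paths of length 3; that is, there exist $\mathbb Z^2$-modules $M,N$ with the same bigraded Betti numbers and a zigzag path $\Gamma$ of length 3 in $\mathbb Z^2$ such that $\mathrm{rk}_M(\Gamma)\ne\mathrm{rk}_N(\Gamma)$.
   Context: Fix a field $k$; a $\mathbb Z^2$-module is a functor from $\mathbb Z^2$ (product order) to finite-dimensional $k$-vector spaces. The bigraded Betti numbers of a finitely generated $\mathbb Z^2$-module $M$ are the functions $\beta_i(M):\mathbb Z^2\to\mathbb Z_{\ge0}$ ($i\ge0$) with $\beta_i(M)(p)$ the multiplicity of the free module $k_{p^\uparrow}$ in the $i$-th term of a minimal free resolution of $M$. Here $p^\uparrow=\{q:p\le q\}$ and $k_{p^\uparrow}$ is the module equal to $k$ on $p^\uparrow$ with identity maps and $0$ elsewhere. A zigzag path of length 3 is a three-point path in $\mathbb Z^2$ of the form $\bullet\to\bullet\leftarrow\bullet$ or $\bullet\leftarrow\bullet\to\bullet$, where an arrow $p\to q$ means $p\le q$. For such a path $\Gamma$, $\mathrm{rk}_M(\Gamma)$ is the rank of the canonical map from the limit to the colimit of the restriction of $M$ to $\Gamma$ (the composite $\varprojlim\to M_p\to\varinjlim$ of structure maps, independent of $p\in\Gamma$). The GRI of $M$ over zigzag paths of length 3 is the function $\Gamma\mapsto\mathrm{rk}_M(\Gamma)$. *)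

(* Defs.v *)
From HB Require Import structures.
From mathcomp Require Import all_boot all_order all_algebra.

Set Implicit Arguments.
Unset Strict Implicit.
Unset Printing Implicit Defensive.
Import Order.TTheory GRing.Theory Num.Theory.
Local Open Scope ring_scope.

Notation Z2 := (int *p int)%type.

Lemma Z2_leE (p q : Z2) : (p <= q)%O = (p.1 <= q.1) && (p.2 <= q.2).
Proof. by []. Qed.

(* Linear maps between products and quotients of vector spaces. *)

Section LinearMaps.
Variable k : fieldType.

Definition pr_l (U V : vectType k) : 'Hom((U * V)%type, U) := linfun fst.
Definition pr_r (U V : vectType k) : 'Hom((U * V)%type, V) := linfun snd.

Definition mk_l (U V : vectType k) (u : U) : (U * V)%type := (u, 0).
Definition mk_r (U V : vectType k) (v : V) : (U * V)%type := (0, v).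

Lemma mk_l_linear (U V : vectType k) : linear (@mk_l U V).
Proof. by move=> a x y; rewrite /mk_l; congr pair; rewrite /= scaler0 addr0. Qed.
Lemma mk_r_linear (U V : vectType k) : linear (@mk_r U V).
Proof. by move=> a x y; rewrite /mk_r; congr pair; rewrite /= scaler0 addr0. Qed.
HB.instance Definition _ (U V : vectType k) :=
  GRing.isLinear.Build k U (U * V)%type _ (@mk_l U V) (@mk_l_linear U V).
HB.instance Definition _ (U V : vectType k) :=
  GRing.isLinear.Build k V (U * V)%type _ (@mk_r U V) (@mk_r_linear U V).

Definition in_l (U V : vectType k) : 'Hom(U, (U * V)%type) := linfun (@mk_l U V).
Definition in_r (U V : vectType k) : 'Hom(V, (U * V)%type) := linfun (@mk_r U V).

Lemma pr_lE (U V : vectType k) x : pr_l U V x = x.1. Proof. by rewrite lfunE. Qed.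
Lemma pr_rE (U V : vectType k) x : pr_r U V x = x.2. Proof. by rewrite lfunE. Qed.
Lemma in_lE (U V : vectType k) u : in_l U V u = (u, 0). Proof. by rewrite lfunE. Qed.
Lemma in_rE (U V : vectType k) v : in_r U V v = (0, v). Proof. by rewrite lfunE. Qed.

Definition pair_lfun (U V U' V' : vectType k) (f : 'Hom(U, U')) (g : 'Hom(V, V')) :
    'Hom((U * V)%type, (U' * V')%type) :=
  (in_l U' V' \o f \o pr_l U V)%VF + (in_r U' V' \o g \o pr_r U V)%VF.

Lemma pair_lfunE (U V U' V' : vectType k) (f : 'Hom(U, U')) (g : 'Hom(V, V')) x :
  pair_lfun f g x = (f x.1, g x.2).
Proof.
rewrite /pair_lfun add_lfunE !comp_lfunE in_lE in_rE pr_lE pr_rE.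
by congr pair; rewrite /= (addr0, add0r).
Qed.

(* The quotient V / W, realised on a complement of W; see [quo_piE]. *)
Definition quo (V : vectType k) (W : {vspace V}) : vectType k := subvs_of W^C%VS.
Definition quo_pi (V : vectType k) (W : {vspace V}) : 'Hom(V, quo W) :=
  (linfun (@vsproj k V W^C%VS) \o daddv_pi W^C%VS W)%VF.

Lemma quo_piE (V : vectType k) (W : {vspace V}) :
  lker (quo_pi W) = W /\ limg (quo_pi W) = fullv.
Proof.
have dx : (W^C :&: W = 0)%VS by rewrite capvC capv_compl.
have dx' : (W :&: W^C = 0)%VS by rewrite capv_compl.
split.
  apply/vspaceP=> v; rewrite memv_ker comp_lfunE lfunE /=.
  rewrite -(inj_eq val_inj) /= vsprojK ?memv_pi //.
  apply/eqP/idP => [v0 | vW].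
    have /(daddv_pi_add dx) <- : v \in (W^C + W)%VS
      by rewrite addvC addv_complf memvf.
    by rewrite v0 add0r memv_pi.
  have := daddv_pi_add dx (subvP (addvSr _ _) _ vW).
  by rewrite (daddv_pi_id dx' vW) => /(canRL (addrK _)); rewrite subrr.
apply/vspaceP=> w; rewrite memvf; apply/memv_imgP.
exists (vsval w); rewrite ?memvf // comp_lfunE lfunE /=.
by rewrite daddv_pi_id ?subvsP // vsvalK.
Qed.

End LinearMaps.

Section Modules.
Variable k : fieldType.

(* [Z2] is a poset with boolean (hence proof-irrelevant) order, so a functor is
   given by its values on the comparable pairs. *)
Record z2module := Z2Module {
  z2sp :> Z2 -> vectType k;
  z2map : forall p q : Z2, (p <= q)%O -> 'Hom(z2sp p, z2sp q);
  z2map_id : forall (p : Z2) (le_pp : (p <= p)%O), z2map le_pp = \1%VF;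
  z2map_comp : forall (p q r : Z2) (le_pq : (p <= q)%O) (le_qr : (q <= r)%O)
      (le_pr : (p <= r)%O),
    z2map le_pr = (z2map le_qr \o z2map le_pq)%VF }.

Record z2hom (M N : z2module) := Z2Hom {
  z2comp :> forall p : Z2, 'Hom(M p, N p);
  z2comp_nat : forall (p q : Z2) (le_pq : (p <= q)%O),
    (z2comp q \o z2map M le_pq = z2map N le_pq \o z2comp p)%VF }.

(* The module [k_{p^uparrow}]: its value at q is k^1 if p <= q and k^0
   otherwise. *)
Definition up_sp (p q : Z2) : vectType k := 'rV[k]_(p <= q)%O.
Definition up_map (p q r : Z2) (_ : (q <= r)%O) : 'Hom(up_sp p q, up_sp p r) :=
  linfun (mulmxr (pid_mx 1)).

Lemma up_map_id (p q : Z2) (le_qq : (q <= q)%O) : up_map p le_qq = \1%VF.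
Proof.
apply/lfunP=> v; rewrite id_lfunE lfunE /=.
have -> : pid_mx 1 = 1%:M :> 'M[k]_(nat_of_bool (p <= q)%O).
  by case: (p <= q)%O; [rewrite pid_mx_1 | apply/matrixP=> -[]].
by rewrite mulmx1.
Qed.

Lemma up_map_comp (p q r s : Z2) (le_qr : (q <= r)%O) (le_rs : (r <= s)%O)
    (le_qs : (q <= s)%O) :
  up_map p le_qs = (up_map p le_rs \o up_map p le_qr)%VF.
Proof.
apply/lfunP=> v; rewrite comp_lfunE !lfunE /= -mulmxA; congr (_ *m _).
case pr : (p <= r)%O; first by rewrite pid_mx_id.
suff pq : (p <= q)%O = false by apply/matrixP=> -[i lt_i]; exfalso; rewrite pq in lt_i.
by apply/negP=> /le_trans /(_ le_qr); rewrite pr.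
Qed.

Definition up (p : Z2) : z2module := Z2Module (@up_map_id p) (@up_map_comp p).

Definition zero_sp (p : Z2) : vectType k := 'rV[k]_0.
Definition zero_map (p q : Z2) (_ : (p <= q)%O) : 'Hom(zero_sp p, zero_sp q) := 0.

Lemma zero_map_id (p : Z2) (le_pp : (p <= p)%O) : zero_map le_pp = \1%VF.
Proof. by apply/lfunP=> v; rewrite [RHS]thinmx0 thinmx0. Qed.

Lemma zero_map_comp (p q r : Z2) (le_pq : (p <= q)%O) (le_qr : (q <= r)%O)
    (le_pr : (p <= r)%O) :
  zero_map le_pr = (zero_map le_qr \o zero_map le_pq)%VF.
Proof. by apply/lfunP=> v; rewrite [RHS]thinmx0 thinmx0. Qed.

Definition zero_module : z2module := Z2Module zero_map_id zero_map_comp.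

Section DirectSum.
Variables M N : z2module.

Definition dsum_sp (p : Z2) : vectType k := (M p * N p)%type.
Definition dsum_map (p q : Z2) (le_pq : (p <= q)%O) : 'Hom(dsum_sp p, dsum_sp q) :=
  pair_lfun (z2map M le_pq) (z2map N le_pq).

Lemma dsum_map_id (p : Z2) (le_pp : (p <= p)%O) : dsum_map le_pp = \1%VF.
Proof.
by apply/lfunP=> -[x y]; rewrite /dsum_map pair_lfunE !z2map_id !id_lfunE.
Qed.

Lemma dsum_map_comp (p q r : Z2) (le_pq : (p <= q)%O) (le_qr : (q <= r)%O)
    (le_pr : (p <= r)%O) :
  dsum_map le_pr = (dsum_map le_qr \o dsum_map le_pq)%VF.
Proof.
apply/lfunP=> x; rewrite comp_lfunE /dsum_map !pair_lfunE /=.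
by rewrite !(z2map_comp _ le_pq le_qr le_pr) !comp_lfunE.
Qed.

Definition dsum : z2module := Z2Module dsum_map_id dsum_map_comp.
End DirectSum.

(* The free module with one summand [up p] for each occurrence of p in s; the
   multiplicity of [up p] is thus [count_mem p s]. *)
Definition free_module (s : seq Z2) : z2module :=
  foldr (fun p F => dsum (up p) F) zero_module s.

Definition finitely_generated (M : z2module) : Prop :=
  exists (s : seq Z2) (f : z2hom (free_module s) M), forall p, limg (f p) = fullv.

Lemma subl_le (p : Z2) : (((p.1 - 1, p.2) : Z2) <= p)%O.
Proof. by rewrite Z2_leE /= lexx andbT gerBl. Qed.
Lemma subr_le (p : Z2) : (((p.1, p.2 - 1) : Z2) <= p)%O.
Proof. by rewrite Z2_leE /= lexx gerBl. Qed.

(* The degree p part of x_1 M + x_2 M = (x_1, x_2) M, where x_1 and x_2 act by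
   the structure maps along the two unit steps. *)
Definition max_ideal_part (M : z2module) (p : Z2) : {vspace M p} :=
  (limg (z2map M (subl_le p)) + limg (z2map M (subr_le p)))%VS.

Record minimal_free_resolution (M : z2module) := MinimalFreeResolution {
  res_grades : nat -> seq Z2;
  res_aug : z2hom (free_module (res_grades 0)) M;
  res_diff : forall i,
    z2hom (free_module (res_grades i.+1)) (free_module (res_grades i));
  res_aug_surj : forall p, limg (res_aug p) = fullv;
  res_exact0 : forall p, limg (res_diff 0 p) = lker (res_aug p);
  res_exact : forall i p, limg (res_diff i.+1 p) = lker (res_diff i p);
  res_minimal : forall i p,
    (limg (res_diff i p) <= max_ideal_part (free_module (res_grades i)) p)%VS }.

(* [beta] is the family of bigraded Betti numbers of M.  This is a relation, but
   minimal free resolutions are unique up to isomorphism. *)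
Definition bigraded_betti (M : z2module) (beta : nat -> Z2 -> nat) : Prop :=
  exists F : minimal_free_resolution M,
    forall i p, beta i p = count_mem p (res_grades F i).

Definition same_bigraded_betti (M N : z2module) : Prop :=
  exists beta : nat -> Z2 -> nat, bigraded_betti M beta /\ bigraded_betti N beta.

End Modules.

(* [ZigzagIn p q r] is p -> q <- r and [ZigzagOut p q r] is p <- q -> r. *)
Inductive zigzag3 : Type :=
| ZigzagIn (p q r : Z2) of (p <= q)%O & (r <= q)%O & uniq [:: p; q; r]
| ZigzagOut (p q r : Z2) of (q <= p)%O & (q <= r)%O & uniq [:: p; q; r].


Section LimitToColimit.
Variables (k : fieldType) (U V W : vectType k).

Let P : vectType k := (U * V * W)%type.
Definition pr1 : 'Hom(P, U) := (pr_l U V \o pr_l (U * V)%type W)%VF.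
Definition pr2 : 'Hom(P, V) := (pr_r U V \o pr_l (U * V)%type W)%VF.
Definition pr3 : 'Hom(P, W) := pr_r (U * V)%type W.
Definition in1 : 'Hom(U, P) := (in_l (U * V)%type W \o in_l U V)%VF.
Definition in2 : 'Hom(V, P) := (in_l (U * V)%type W \o in_r U V)%VF.
Definition in3 : 'Hom(W, P) := in_r (U * V)%type W.

(* For a subspace L of the product and a quotient P / R of the direct sum, the
   composite L -> V -> P / R through the middle space. *)
Definition through_mid (L R : {vspace P}) : 'Hom(subvs_of L, quo R) :=
  (quo_pi R \o in2 \o pr2 \o linfun (vsval : subvs_of L -> P))%VF.

(* Limit and colimit of U -f-> V <-g- W. *)
Definition lim_in (f : 'Hom(U, V)) (g : 'Hom(W, V)) : {vspace P} :=
  (lker ((f \o pr1)%VF - pr2) :&: lker ((g \o pr3)%VF - pr2))%VS.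
Definition colim_in_rel (f : 'Hom(U, V)) (g : 'Hom(W, V)) : {vspace P} :=
  (limg (in1 - (in2 \o f)%VF) + limg (in3 - (in2 \o g)%VF))%VS.
Definition rk_in (f : 'Hom(U, V)) (g : 'Hom(W, V)) : nat :=
  \dim (limg (through_mid (lim_in f g) (colim_in_rel f g))).

Lemma mem_lim_in (f : 'Hom(U, V)) (g : 'Hom(W, V)) v :
  (v \in lim_in f g) = (f (pr1 v) == pr2 v) && (g (pr3 v) == pr2 v).
Proof.
rewrite memv_cap !memv_ker !add_lfunE !opp_lfunE !subr_eq0.
by rewrite [(f \o _)%VF _]comp_lfunE [(g \o _)%VF _]comp_lfunE.
Qed.

Lemma through_in_indep (f : 'Hom(U, V)) (g : 'Hom(W, V)) v :
    v \in lim_in f g ->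
  let pi := quo_pi (colim_in_rel f g) in
  pi (in1 (pr1 v)) = pi (in2 (pr2 v)) /\ pi (in3 (pr3 v)) = pi (in2 (pr2 v)).
Proof.
have [kerR _] := quo_piE (colim_in_rel f g); rewrite mem_lim_in.
case/andP=> /eqP fE /eqP gE pi.
split; apply/eqP; rewrite -subr_eq0 -raddfB /= -memv_ker kerR.
  apply: subvP (addvSl _ _) _ _; apply/memv_imgP; exists (pr1 v); rewrite ?memvf //.
  by rewrite add_lfunE opp_lfunE [(in2 \o f)%VF _]comp_lfunE fE.
apply: subvP (addvSr _ _) _ _; apply/memv_imgP; exists (pr3 v); rewrite ?memvf //.
by rewrite add_lfunE opp_lfunE [(in2 \o g)%VF _]comp_lfunE gE.
Qed.

(* Limit and colimit of U <-f- V -g-> W. *)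
Definition lim_out (f : 'Hom(V, U)) (g : 'Hom(V, W)) : {vspace P} :=
  (lker ((f \o pr2)%VF - pr1) :&: lker ((g \o pr2)%VF - pr3))%VS.
Definition colim_out_rel (f : 'Hom(V, U)) (g : 'Hom(V, W)) : {vspace P} :=
  (limg (in2 - (in1 \o f)%VF) + limg (in2 - (in3 \o g)%VF))%VS.
Definition rk_out (f : 'Hom(V, U)) (g : 'Hom(V, W)) : nat :=
  \dim (limg (through_mid (lim_out f g) (colim_out_rel f g))).

Lemma mem_lim_out (f : 'Hom(V, U)) (g : 'Hom(V, W)) v :
  (v \in lim_out f g) = (f (pr2 v) == pr1 v) && (g (pr2 v) == pr3 v).
Proof.
rewrite memv_cap !memv_ker !add_lfunE !opp_lfunE !subr_eq0.
by rewrite [(f \o _)%VF _]comp_lfunE [(g \o _)%VF _]comp_lfunE.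
Qed.

Lemma through_out_indep (f : 'Hom(V, U)) (g : 'Hom(V, W)) v :
    v \in lim_out f g ->
  let pi := quo_pi (colim_out_rel f g) in
  pi (in1 (pr1 v)) = pi (in2 (pr2 v)) /\ pi (in3 (pr3 v)) = pi (in2 (pr2 v)).
Proof.
have [kerR _] := quo_piE (colim_out_rel f g); rewrite mem_lim_out.
case/andP=> /eqP fE /eqP gE pi.
split; apply/esym/eqP; rewrite -subr_eq0 -raddfB /= -memv_ker kerR.
  apply: subvP (addvSl _ _) _ _; apply/memv_imgP; exists (pr2 v); rewrite ?memvf //.
  by rewrite add_lfunE opp_lfunE [(in1 \o f)%VF _]comp_lfunE fE.
apply: subvP (addvSr _ _) _ _; apply/memv_imgP; exists (pr2 v); rewrite ?memvf //.
by rewrite add_lfunE opp_lfunE [(in3 \o g)%VF _]comp_lfunE gE.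
Qed.

End LimitToColimit.

Definition rk (k : fieldType) (M : z2module k) (Gamma : zigzag3) : nat :=
  match Gamma with
  | ZigzagIn p q r le_pq le_rq _ => rk_in (z2map M le_pq) (z2map M le_rq)
  | ZigzagOut p q r le_qp le_qr _ => rk_out (z2map M le_qp) (z2map M le_qr)
  end.

(* Main.v *)
(* Put a = (0,0), b = (1,0), c = (2,0), and let a single relation in degree c
   kill one of two generators, placed in degrees a and b.  Killing the generator
   at a gives M = up a / up c + up b, killing the one at b gives
   N = up b / up c + up a; both have minimal resolution
   0 -> up c -> up a + up b, hence the same Betti numbers.  Along
   (0,1) -> (2,1) <- (1,0) the rank is the dimension of the intersection of the
   two images; at (0,1) only the generator at a is alive, and it reaches (2,1) in
   N but not in M. *)

Require Import Defs.
From mathcomp Require Import all_boot all_order all_algebra.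

Set Implicit Arguments.
Unset Strict Implicit.
Unset Printing Implicit Defensive.
Import Order.TTheory GRing.Theory Num.Theory.
Local Open Scope ring_scope.

(** * Rank of a cospan *)

(** The colimit of a cospan is its middle space, and its limit is the fibre product, which maps onto
    the intersection of the two images. *)
Lemma rk_inE (k : fieldType) (U V W : vectType k) (f : 'Hom(U, V)) (g : 'Hom(W, V)) :
  rk_in f g = \dim (limg f :&: limg g).
Proof.
pose R := colim_in_rel f g; pose L := lim_in f g.
have [kerR _] := quo_piE R.
(* [fold] vanishes on the relations [R] and is a left inverse of [in2]; hence [in2] followed by the
   quotient map is injective and preserves dimensions. *)
pose fold := ((f \o @pr1 k U V W) + @pr2 k U V W + (g \o @pr3 k U V W))%VF.
have foldE u v w : fold (u, v, w) = f u + v + g w.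
  rewrite /fold !add_lfunE [(f \o _)%VF _]comp_lfunE [(g \o _)%VF _]comp_lfunE.
  by rewrite [pr1 _ _ _ _]comp_lfunE [pr2 _ _ _ _]comp_lfunE !(pr_lE, pr_rE).
have in1E u : in1 U V W u = (u, 0, 0) by rewrite [in1 _ _ _ _]comp_lfunE !in_lE.
have in2E v : in2 U V W v = (0, v, 0) by rewrite [in2 _ _ _ _]comp_lfunE in_lE in_rE.
have in3E w : in3 U V W w = (0, 0, w) by rewrite /in3 in_rE.
have subR : (R <= lker fold)%VS.
  rewrite subv_add; apply/andP; split; apply/subvP=> _ /memv_imgP[u _ ->];
    rewrite memv_ker add_lfunE opp_lfunE [(in2 _ _ _ \o _)%VF _]comp_lfunE.
    by rewrite raddfB /= in1E in2E !foldE !linear0 !addr0 add0r subrr.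
  by rewrite raddfB /= in3E in2E !foldE !linear0 !addr0 !add0r subrr.
have lE (l : subvs_of L) :
    (@pr2 k U V W \o linfun (vsval : subvs_of L -> (U * V * W)%type))%VF l
      = pr2 U V W (vsval l).
  by rewrite [LHS]comp_lfunE; congr (pr2 _ _ _ _); apply: lfunE.
have imL : limg (@pr2 k U V W \o linfun (vsval : subvs_of L -> (U * V * W)%type))%VF
    = (limg f :&: limg g)%VS.
  apply/vspaceP=> v; rewrite memv_cap; apply/memv_imgP/andP.
    case=> l _ ->; rewrite lE.
    have := subvsP l; rewrite mem_lim_in => /andP[/eqP fE /eqP gE].
    by split; [rewrite -fE | rewrite -gE]; rewrite memv_img ?memvf.
  case=> /memv_imgP[u _ uE] /memv_imgP[w _ wE].
  have vL : (u, v, w) \in L.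
    rewrite mem_lim_in [pr1 _ _ _ _]comp_lfunE [pr2 _ _ _ _]comp_lfunE.
    by rewrite !(pr_lE, pr_rE) /= -uE -wE eqxx.
  exists (Subvs vL); rewrite ?memvf // lE /=.
  by rewrite [pr2 _ _ _ _]comp_lfunE pr_lE pr_rE.
rewrite /rk_in /through_mid -/R -/L -comp_lfunA limg_comp imL.
apply: limg_dim_eq; apply/eqP; rewrite -subv0; apply/subvP=> v.
rewrite memv_cap memv_ker comp_lfunE -memv_ker kerR memv0 => /andP[_ /(subvP subR)].
by rewrite memv_ker in2E foldE !linear0 add0r addr0.
Qed.

(** * Canonical maps between spaces of dimension 0 or 1 *)

Section BoolDim.
Variable k : fieldType.
Implicit Types a b c : bool.

(** The body of [up_map] for arbitrary booleans: the identity of [k] when both hold, zero otherwise.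
    The structure maps of [up] and [strip] are convertible to it. *)
Definition pidl a b : 'Hom('rV[k]_a, 'rV[k]_b) := linfun (mulmxr (pid_mx 1)).

Lemma pidl_id a : pidl a a = \1%VF.
Proof.
apply/lfunP=> v; rewrite id_lfunE lfunE /=.
by case: a v => v; rewrite ?thinmx0 // pid_mx_1 mulmx1.
Qed.

(** The hypothesis excludes the one bad case, a passage from [k] to [k] through 0. *)
Lemma pidl_comp a b c : (a && c ==> b) -> (pidl b c \o pidl a b)%VF = pidl a c.
Proof.
move=> abc; apply/lfunP=> v; rewrite comp_lfunE !lfunE /= -mulmxA; congr (_ *m _).
case: a v abc => v; last by move=> _; apply/matrixP=> -[].
by case: b; case: c => // _; [exact: pid_mx_id | rewrite [RHS]thinmx0 thinmx0 ..].
Qed.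

Lemma rV_false b (v : 'rV[k]_b) : b = false -> v = 0.
Proof. by case: b v => // v _; apply: thinmx0. Qed.

Lemma pidl_const a b (t : k) : a -> pidl a b (const_mx t) = const_mx t.
Proof.
case: a => // _; rewrite lfunE /=; case: b; last by rewrite [RHS]thinmx0 thinmx0.
by rewrite pid_mx_1 mulmx1.
Qed.

(** [pidl b a] is a left inverse. *)
Lemma lker_pidl a b : (a ==> b) -> lker (pidl a b) = 0%VS.
Proof.
move=> ab; apply/eqP; rewrite -subv0; apply/subvP=> v; rewrite memv_ker memv0.
move=> /eqP v0; have : (pidl b a \o pidl a b)%VF v = v.
  by rewrite pidl_comp ?pidl_id ?id_lfunE //; move: ab; case: a v v0; case: b.
by rewrite comp_lfunE v0 linear0 => <-.
Qed.

Lemma limg_pidl a b : (b ==> a) -> limg (pidl a b) = fullv.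
Proof.
move=> ba; apply/vspaceP=> v; rewrite memvf; apply/memv_imgP.
exists (pidl b a v); rewrite ?memvf // -comp_lfunE pidl_comp ?pidl_id ?id_lfunE //.
by move: ba; case: a v; case: b.
Qed.

(** This gives exactness of [up c -> up x -> strip x c] in one degree, [a] and [b] telling whether
    it lies above [x] and [c]. Both sides are everything if [b] holds, zero otherwise. *)
Lemma pidl_exact a b : (b ==> a) -> limg (pidl b a) = lker (pidl a (a && ~~ b)).
Proof.
case: b => [|_].
  case: a => // _; rewrite limg_pidl //; apply/esym/vspaceP=> v.
  by rewrite memvf memv_ker; apply/eqP/rV_false.
rewrite lker_pidl; last by rewrite andbT implybb.
apply/eqP; rewrite -subv0; apply/subvP=> _ /memv_imgP[u _ ->].
by rewrite (@rV_false false u) // linear0 mem0v.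
Qed.

End BoolDim.

(** * The minimal resolution when one of two generators is killed *)

Section Strip.
Variable k : fieldType.

Lemma z2map_dsumE (A B : z2module k) (p q : Z2) (le_pq : (p <= q)%O)
    (v : dsum A B p) :
  z2map (dsum A B) le_pq v = (z2map A le_pq v.1, z2map B le_pq v.2).
Proof. exact: pair_lfunE. Qed.

Definition strip_supp (x c p : Z2) : bool := (x <= p)%O && ~~ (c <= p)%O.

Definition strip_map (x c p q : Z2) (_ : (p <= q)%O) :
    'Hom('rV[k]_(strip_supp x c p), 'rV[k]_(strip_supp x c q)) := pidl k _ _.

Lemma strip_map_id (x c p : Z2) (le_pp : (p <= p)%O) : strip_map x c le_pp = \1%VF.
Proof. exact: pidl_id. Qed.

(** The support is convex: being above [x] passes upwards, not being above [c] passes downwards. *)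
Lemma strip_map_comp (x c p q r : Z2) (le_pq : (p <= q)%O) (le_qr : (q <= r)%O)
    (le_pr : (p <= r)%O) :
  strip_map x c le_pr = (strip_map x c le_qr \o strip_map x c le_pq)%VF.
Proof.
rewrite /strip_map pidl_comp //; apply/implyP=> /andP[/andP[xp _] /andP[_ cr]].
by rewrite /strip_supp (le_trans xp) //=; apply: contra cr => /le_trans; apply.
Qed.

(* For x <= c this is the quotient of [up x] by [up c]. *)
Definition strip (x c : Z2) : z2module k :=
  Z2Module (@strip_map_id x c) (@strip_map_comp x c).

Variables (x y c : Z2).
Hypothesis lt_xc : (x < c)%O.

Let F0 := free_module k [:: x; y].
Let F1 := free_module k [:: c].
Let M := dsum (strip x c) (up k y).

Definition up_incl p : 'Hom(up k c p, up k x p) := pidl k _ _.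
Definition up_proj p : 'Hom(up k x p, strip x c p) := pidl k _ _.

Lemma up_incl_nat p q (le_pq : (p <= q)%O) :
  (up_incl q \o z2map (up k c) le_pq = z2map (up k x) le_pq \o up_incl p)%VF.
Proof.
rewrite /up_incl [z2map _ _]/(pidl k _ _) [z2map (up k x) _]/(pidl k _ _).
rewrite !pidl_comp //; apply/implyP=> /andP[cp _].
  exact: le_trans (ltW lt_xc) cp.
exact: le_trans cp le_pq.
Qed.

Lemma up_proj_nat p q (le_pq : (p <= q)%O) :
  (up_proj q \o z2map (up k x) le_pq = z2map (strip x c) le_pq \o up_proj p)%VF.
Proof.
rewrite /up_proj [z2map _ _]/(pidl k _ _) [z2map (strip x c) _]/(pidl k _ _).
rewrite !pidl_comp //; apply/implyP=> /andP[xp].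
  by case/andP=> _ cq; rewrite /strip_supp xp; apply: contra cq => /le_trans; apply.
by move=> _; exact: le_trans xp le_pq.
Qed.

(** [free_module] ends every sum with [zero_module]; [pr_l] drops that trailing term. *)
Definition strip_aug_comp p : 'Hom(F0 p, M p) :=
  pair_lfun (up_proj p) (pr_l (up k y p) (zero_module k p)).

Lemma strip_aug_nat p q (le_pq : (p <= q)%O) :
  (strip_aug_comp q \o z2map F0 le_pq = z2map M le_pq \o strip_aug_comp p)%VF.
Proof.
apply/lfunP=> v; rewrite !comp_lfunE /strip_aug_comp.
rewrite pair_lfunE !z2map_dsumE /= pair_lfunE !pr_lE /= -!comp_lfunE.
by congr pair; have /lfunP/(_ v.1) := up_proj_nat le_pq.
Qed.

Definition strip_aug : z2hom F0 M := Z2Hom strip_aug_nat.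

Definition strip_diff_comp p : 'Hom(F1 p, F0 p) :=
  (in_l (up k x p) (free_module k [:: y] p)
    \o up_incl p \o pr_l (up k c p) (zero_module k p))%VF.

Lemma strip_diff_compE p v : strip_diff_comp p v = (up_incl p v.1, 0).
Proof. by rewrite !comp_lfunE /= pr_lE in_lE. Qed.

Lemma strip_diff_nat p q (le_pq : (p <= q)%O) :
  (strip_diff_comp q \o z2map F1 le_pq = z2map F0 le_pq \o strip_diff_comp p)%VF.
Proof.
apply/lfunP=> v; rewrite [LHS]comp_lfunE [RHS]comp_lfunE !strip_diff_compE.
rewrite !z2map_dsumE /= !linear0 -!comp_lfunE.
by congr pair; have /lfunP/(_ v.1) := up_incl_nat le_pq.
Qed.

Definition strip_diff : z2hom F1 F0 := Z2Hom strip_diff_nat.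

Lemma zero_hom_nat (A B : z2module k) p q (le_pq : (p <= q)%O) :
  ((0 : 'Hom(A q, B q)) \o z2map A le_pq = z2map B le_pq \o (0 : 'Hom(A p, B p)))%VF.
Proof. by apply/lfunP=> v; rewrite !comp_lfunE !zero_lfunE linear0. Qed.

Definition zero_hom (A B : z2module k) : z2hom A B := Z2Hom (@zero_hom_nat A B).

Lemma limg_zero_hom (A B : z2module k) p : limg (zero_hom A B p) = 0%VS.
Proof.
apply/eqP; rewrite -subv0; apply/subvP=> _ /memv_imgP[u _ ->].
by rewrite zero_lfunE mem0v.
Qed.

Definition strip_grades (i : nat) : seq Z2 :=
  match i with 0 => [:: x; y] | 1 => [:: c] | _ => [::] end.

Definition strip_res_diff (i : nat) :
    z2hom (free_module k (strip_grades i.+1)) (free_module k (strip_grades i)) :=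
  match i with 0 => strip_diff | _ => zero_hom _ _ end.

Lemma strip_aug_surj p : limg (strip_aug p) = fullv.
Proof.
apply/vspaceP=> -[u v]; rewrite memvf; apply/memv_imgP.
have : u \in limg (up_proj p) by rewrite limg_pidl ?memvf //; apply/implyP=> /andP[].
case/memv_imgP=> w _ ->.
by exists (w, (v, 0)); rewrite ?memvf //= pair_lfunE /= pr_lE.
Qed.

(** The relation involves only the [x] summand, and the [y] summand is mapped isomorphically, so
    [pidl_exact] suffices. *)
Lemma strip_exact0 p : limg (strip_diff p) = lker (strip_aug p).
Proof.
have ex : limg (up_incl p) = lker (up_proj p).
  by apply: pidl_exact; apply/implyP; apply: le_trans (ltW lt_xc).
apply/vspaceP=> -[u [v w]]; rewrite memv_ker /= pair_lfunE /= pr_lE /=.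
apply/memv_imgP/eqP.
  case=> s _; rewrite /= strip_diff_compE => -[-> -> _].
  have : up_incl p s.1 \in lker (up_proj p) by rewrite -ex memv_img ?memvf.
  by rewrite memv_ker => /eqP ->.
case=> u0 ->; have : u \in limg (up_incl p) by rewrite ex memv_ker u0.
case/memv_imgP=> s _ ->; exists (s, 0); rewrite ?memvf //= strip_diff_compE /=.
by rewrite (thinmx0 w).
Qed.

(** For [i = 0] this is injectivity of [up c -> up x]; beyond that the source is zero. *)
Lemma strip_exact i p : limg (strip_res_diff i.+1 p) = lker (strip_res_diff i p).
Proof.
rewrite limg_zero_hom; apply/esym/eqP; rewrite -subv0; case: i => [|i];
  apply/subvP=> v; rewrite memv_ker memv0; last by rewrite (thinmx0 v).
case: v => v w; rewrite /= strip_diff_compE (thinmx0 w) => /eqP[v0].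
have : v \in lker (up_incl p) by rewrite memv_ker v0.
rewrite lker_pidl ?memv0; first by move/eqP->.
by apply/implyP; apply: le_trans (ltW lt_xc).
Qed.

(** Some coordinate is strictly larger and can be lowered by one. *)
Lemma lt_pred_le (p : Z2) : (x < p)%O ->
  (x <= ((p.1 - 1, p.2) : Z2))%O || (x <= ((p.1, p.2 - 1) : Z2))%O.
Proof.
case: x p => x1 x2 [p1 p2]; rewrite lt_neqAle !Z2_leE /= => /andP[ne /andP[l1 l2]].
rewrite !lerBrDr !lezD1 l1 l2 andbT /= !lt_neqAle l1 l2 !andbT.
by move: ne; rewrite xpair_eqE negb_and.
Qed.

(** In a degree above [c] the generator at [x] is already alive one unit step earlier. *)
Lemma strip_minimal i p :
  (limg (strip_res_diff i p)
    <= max_ideal_part (free_module k (strip_grades i)) p)%VS.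
Proof.
case: i => [|i]; last by rewrite limg_zero_hom sub0v.
apply/subvP=> _ /memv_imgP[[v w] _ ->]; rewrite /= strip_diff_compE /=.
have [cp|/negbTE ncp] := boolP (c <= p)%O; last first.
  by rewrite (rV_false v ncp) linear0 mem0v.
have lift q (le_qp : (q <= p)%O) : (x <= q)%O ->
    (up_incl p v, 0) \in limg (z2map F0 le_qp).
  move=> xq; apply/memv_imgP.
  (* The lift lives in [up x], since [up c] may vanish at [q]. *)
  exists ((pidl k (c <= p)%O (x <= q)%O v, 0) : F0 q); rewrite ?memvf //.
  rewrite z2map_dsumE /= linear0; congr pair.
  rewrite [up_map _ _ _]/(pidl k _ _) -comp_lfunE pidl_comp //.
  by rewrite xq implybT.
case/orP: (lt_pred_le (lt_le_trans lt_xc cp)) => xq.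
  exact: subvP (addvSl _ _) _ (lift _ (subl_le p) xq).
exact: subvP (addvSr _ _) _ (lift _ (subr_le p) xq).
Qed.

Definition strip_resolution : minimal_free_resolution M :=
  @MinimalFreeResolution k M strip_grades strip_aug strip_res_diff
    strip_aug_surj strip_exact0 strip_exact strip_minimal.

Lemma strip_finitely_generated : finitely_generated M.
Proof. by exists [:: x; y], strip_aug; exact: strip_aug_surj. Qed.

End Strip.

(** * Equal Betti numbers, different ranks *)

Lemma strip_same_betti (k : fieldType) (x y c : Z2) : (x < c)%O -> (y < c)%O ->
  same_bigraded_betti (dsum (strip k x c) (up k y)) (dsum (strip k y c) (up k x)).
Proof.
move=> xc yc; exists (fun i p => count_mem p (strip_grades x y c i)); split.
  by exists (strip_resolution k y xc).
exists (strip_resolution k x yc) => -[|[|i]] p //=.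
(* The generators are listed as [x, y] and as [y, x]; the counts agree up to order. *)
by rewrite addnCA.
Qed.

Theorem proposition4p26 (k : fieldType) :
  exists M N : z2module k,
    [/\ finitely_generated M, finitely_generated N, same_bigraded_betti M N
      & exists Gamma : zigzag3, rk M Gamma <> rk N Gamma].
Proof.
pose a : Z2 := (0, 0); pose b : Z2 := (1, 0); pose c : Z2 := (2, 0).
(* [p] is above [a] but not [b], and [q] is above [c]. The point [b] doubles as the other end of the
   path: it is above [a] too. *)
pose p : Z2 := (0, 1); pose q : Z2 := (2, 1).
have ac : (a < c)%O by [].
have bc : (b < c)%O by [].
have pq : (p <= q)%O by [].
have bq : (b <= q)%O by [].
have pqb : uniq [:: p; q; b] by [].
exists (dsum (strip k a c) (up k b)), (dsum (strip k b c) (up k a)); split.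
- exact: strip_finitely_generated.
- exact: strip_finitely_generated.
- exact: strip_same_betti.
exists (ZigzagIn pq bq pqb); rewrite /rk !rk_inE.
set M := dsum (strip k a c) _; set N := dsum (strip k b c) _.
have -> : \dim (limg (z2map M pq) :&: limg (z2map M bq)) = 0%N.
  (* The image from [p] is already zero: [up b] vanishes at [p], and the strip vanishes at [q]. *)
  apply/eqP; rewrite dimv_eq0 -subv0; apply: subv_trans (capvSl _ _) _.
  apply/subvP=> _ /memv_imgP[[u v] _ ->]; rewrite z2map_dsumE /=.
  rewrite (rV_false v) ?linear0 // memv0; apply/eqP; congr pair.
  by apply: (@rV_false k (strip_supp a c q)).
apply/eqP; rewrite eq_sym dimv_eq0; apply/eqP=> cap0.
(* The generator at [a], carried to each degree [r] above [a]. It is alive at both ends of the path,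
   so [w q] lies in both images. *)
pose w r : N r := (0, const_mx 1).
have wE r (le_rq : (r <= q)%O) : (a <= r)%O -> z2map N le_rq (w r) = w q.
  move=> ar; rewrite z2map_dsumE /= linear0; congr pair.
  exact: (@pidl_const k _ (a <= q)%O 1 ar).
have : w q \in (limg (z2map N pq) :&: limg (z2map N bq))%VS.
  by rewrite memv_cap -{1}(wE _ pq) // -(wE _ bq) // !memv_img ?memvf.
(* The only entry of the second component of [w q] is 1. *)
rewrite cap0 memv0 => /eqP[/matrixP/(_ ord0 (@ord0 0))].
by rewrite !mxE => /eqP; rewrite oner_eq0.
Qed.
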